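(* Let $n,m,m_d,N$ be positive integers, and let $\dot X\in\mathbb{R}^{n\times N}$, $X\in\mathbb{R}^{n\times N}$, $U\in\mathbb{R}^{m\times N}$ be data matrices, $B_d\in\mathbb{R}^{n\times m_d}$ a matrix of full column rank, and $Q_d=Q_d^\top\in\mathbb{R}^{N\times N}$, $S_d\in\mathbb{R}^{N\times m_d}$, $R_d=R_d^\top\in\mathbb{R}^{m_d\times m_d}$ with $Q_d\prec 0$, as in the data setting of the context. Let $\Sigma_c$ be the set of all pairs $(A,B)\in\mathbb{R}^{n\times n}\times\mathbb{R}^{n\times m}$ for which there exists $D\in\mathcal{D}$ with $\dot X=AX+BU+B_dD$. Then $$\Sigma_c=\left\{(A,B)\in\mathbb{R}^{n\times n}\times\mathbb{R}^{n\times m}\ \middle|\ \begin{bmatrix}\begin{bmatrix}A&B\end{bmatrix}^\top\\ I\end{bmatrix}^\top P_c\begin{bmatrix}\begin{bmatrix}A&B\end{bmatrix}^\top\\ I\end{bmatrix}\succeq 0\right\},$$ where $\mathcal{D}$ and $P_c$ are defined in the context.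
   Context: Data setting. The columns of $\dot X=[\dot x(\tau_1)\ \cdots\ \dot x(\tau_N)]$, $X=[x(\tau_1)\ \cdots\ x(\tau_N)]$, $U=[u(\tau_1)\ \cdots\ u(\tau_N)]$ are measurements, at not necessarily equidistant times $\tau_1,\dots,\tau_N$, of a system $\dot x(t)=A_{\mathrm{tr}}x(t)+B_{\mathrm{tr}}u(t)+B_dd(t)$ with unknown $A_{\mathrm{tr}}\in\mathbb{R}^{n\times n}$, $B_{\mathrm{tr}}\in\mathbb{R}^{n\times m}$ and unknown disturbance; that is, $\dot X=A_{\mathrm{tr}}X+B_{\mathrm{tr}}U+B_d\hat D$ for some (unknown) $\hat D\in\mathcal{D}$. The matrix $B_d$ is known and has full column rank. Noise set: $$\mathcal{D}=\left\{D\in\mathbb{R}^{m_d\times N}\ \middle|\ \begin{bmatrix}D^\top\\ I\end{bmatrix}^\top\begin{bmatrix}Q_d&S_d\\ S_d^\top&R_d\end{bmatrix}\begin{bmatrix}D^\top\\ I\end{bmatrix}\succeq 0\right\}.$$ Define $Z=\begin{bmatrix}X\\ U\end{bmatrix}\in\mathbb{R}^{(n+m)\times N}$ and $$P_c=\begin{bmatrix}-Z&0\\ \dot X&B_d\end{bmatrix}\begin{bmatrix}Q_d&S_d\\ S_d^\top&R_d\end{bmatrix}\begin{bmatrix}-Z&0\\ \dot X&B_d\end{bmatrix}^\top\in\mathbb{R}^{(2n+m)\times(2n+m)}.$$ For symmetric matrices, $\succ,\succeq,\prec,\preceq$ denote positive definite, positive semidefinite, negative definite, negative semidefinite; $I$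 and $0$ denote identity and zero matrices of appropriate size. *)

(* Defs.v *)
From HB Require Import structures.
From mathcomp Require Import all_boot all_order all_algebra.
From mathcomp Require Import classical_sets reals.

Set Implicit Arguments.
Unset Strict Implicit.
Unset Printing Implicit Defensive.

Import Order.TTheory GRing.Theory Num.Theory.

Local Open Scope ring_scope.
Local Open Scope classical_set_scope.

(* Definiteness includes symmetry, as it is only meant for symmetric matrices. *)
Definition psdmx (R : realType) (k : nat) (M : 'M[R]_k) : Prop :=
  M^T = M /\ forall v : 'cV[R]_k, 0 <= (v^T *m M *m v) 0 0.

Definition negdefmx (R : realType) (k : nat) (M : 'M[R]_k) : Prop :=
  M^T = M /\ forall v : 'cV[R]_k, v != 0 -> (v^T *m M *m v) 0 0 < 0.

Definition noise_mx (R : realType) (N md : nat) (Qd : 'M[R]_N)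
    (Sd : 'M[R]_(N, md)) (Rd : 'M[R]_md) : 'M[R]_(N + md) :=
  block_mx Qd Sd Sd^T Rd.

Definition noise_set (R : realType) (N md : nat) (Qd : 'M[R]_N)
    (Sd : 'M[R]_(N, md)) (Rd : 'M[R]_md) : set 'M[R]_(md, N) :=
  [set D | psdmx ((col_mx D^T 1%:M)^T *m noise_mx Qd Sd Rd
                   *m col_mx D^T 1%:M)].

(* The index n + m + n stands for 2n + m, in the block order (x, u, xdot). *)
Definition data_mx (R : realType) (n m md N : nat) (Xdot X : 'M[R]_(n, N))
    (U : 'M[R]_(m, N)) (Bd : 'M[R]_(n, md)) : 'M[R]_(n + m + n, N + md) :=
  block_mx (- col_mx X U) 0 Xdot Bd.

Definition Pc (R : realType) (n m md N : nat) (Xdot X : 'M[R]_(n, N))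
    (U : 'M[R]_(m, N)) (Bd : 'M[R]_(n, md)) (Qd : 'M[R]_N)
    (Sd : 'M[R]_(N, md)) (Rd : 'M[R]_md) : 'M[R]_(n + m + n) :=
  data_mx Xdot X U Bd *m noise_mx Qd Sd Rd *m (data_mx Xdot X U Bd)^T.

Definition Sigma_c (R : realType) (n m md N : nat) (Xdot X : 'M[R]_(n, N))
    (U : 'M[R]_(m, N)) (Bd : 'M[R]_(n, md)) (Qd : 'M[R]_N)
    (Sd : 'M[R]_(N, md)) (Rd : 'M[R]_md) : set ('M[R]_n * 'M[R]_(n, m)) :=
  [set AB | exists D : 'M[R]_(md, N), noise_set Qd Sd Rd D /\
              Xdot = AB.1 *m X + AB.2 *m U + Bd *m D].

(* Main.v *)
(* With E := Xdot - A X - B U, the matrix inequality in (A, B) reads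
   [E Bd] W [E Bd]^T >= 0, where W is the noise matrix. If E = Bd D, the left-hand
   side is Bd ([D I] W [D I]^T) Bd^T, and since Bd has a left inverse, this
   congruence preserves and reflects semidefiniteness. Conversely, a vector v
   with Bd^T v = 0 gives (E^T v)^T Qd (E^T v) >= 0, hence E^T v = 0 as Qd < 0;
   so the columns of E lie in the column space of Bd, i.e. E = Bd D. *)

Require Import Defs.
From HB Require Import structures.
From mathcomp Require Import all_boot all_order all_algebra.
From mathcomp Require Import classical_sets reals.

Import Order.TTheory GRing.Theory Num.Theory.

Local Open Scope ring_scope.
Local Open Scope classical_set_scope.

Lemma psdmx_congr {R : realType} {p q : nat} (L : 'M[R]_(p, q)) {M : 'M[R]_q} :
  psdmx M -> psdmx (L *m M *m L^T).
Proof.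
move=> [symM posM]; split; first by rewrite !trmx_mul trmxK symM mulmxA.
by move=> v; have := posM (L^T *m v); rewrite trmx_mul trmxK !mulmxA.
Qed.

Lemma negdefmx_isotropic {R : realType} {k : nat} {Q : 'M[R]_k} {v : 'cV[R]_k} :
  negdefmx Q -> 0 <= (v^T *m Q *m v) 0 0 -> v = 0.
Proof.
move=> [_ negQ] v_ge0; apply/eqP; apply/negPn/negP => /negQ.
by rewrite ltNge v_ge0.
Qed.

Lemma psdmx_row_mx_factor {R : realType} {n md N : nat} {E : 'M[R]_(n, N)}
    {B : 'M[R]_(n, md)} {Q : 'M[R]_N} {S : 'M[R]_(N, md)} {T : 'M[R]_md} :
  negdefmx Q -> psdmx (row_mx E B *m noise_mx Q S T *m (row_mx E B)^T) ->
  exists D, E = B *m D.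
Proof.
move=> negQ [_ posM].
(* [submx] compares row spaces, so the column space inclusion is stated on transposes. By [submxE]
   it can be tested on the columns of [cokermx B^T], which [B^T] annihilates. *)
suff /submxP[D ED] : (E^T <= B^T)%MS.
  by exists D^T; rewrite -[LHS]trmxK ED trmx_mul trmxK.
rewrite submxE; apply/eqP/matrixP => i j; rewrite [RHS]mxE.
pose v := col j (cokermx B^T).
have Bv0 : B^T *m v = 0 by rewrite /v colE mulmxA mulmx_coker mul0mx.
suff : E^T *m v = 0 by rewrite /v colE mulmxA -colE => /matrixP/(_ i 0); rewrite !mxE.
apply: negdefmx_isotropic negQ _; have := posM v.
have -> : v^T *m (row_mx E B *m noise_mx Q S T *m (row_mx E B)^T) *m v =
    ((row_mx E B)^T *m v)^T *m noise_mx Q S T *m ((row_mx E B)^T *m v).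
  by rewrite trmx_mul trmxK !mulmxA.
(* The lower block [B^T *m v] vanishes, so only the [Q] term survives, evaluated at [E^T *m v]. *)
rewrite tr_row_mx mul_col_mx Bv0 tr_col_mx trmx0 /noise_mx mul_row_block.
by rewrite !mul0mx !addr0 mul_row_col mulmx0 addr0.
Qed.

(** Left multiplication by [[A B I]] collapses [data_mx] to the residual block next to [Bd]. *)
Lemma tr_col_mx_Pc {R : realType} {n m md N : nat} (Xdot X : 'M[R]_(n, N))
    (U : 'M[R]_(m, N)) (Bd : 'M[R]_(n, md)) (Qd : 'M[R]_N)
    (Sd : 'M[R]_(N, md)) (Rd : 'M[R]_md) (A : 'M[R]_n) (B : 'M[R]_(n, m)) :
  let F := row_mx (Xdot - (A *m X + B *m U)) Bd in
  (col_mx (row_mx A B)^T 1%:M)^T *m Pc Xdot X U Bd Qd Sd Rd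
    *m col_mx (row_mx A B)^T 1%:M = F *m noise_mx Qd Sd Rd *m F^T.
Proof.
move=> F; have <- : (col_mx (row_mx A B)^T 1%:M)^T *m data_mx Xdot X U Bd = F.
  rewrite tr_col_mx trmxK trmx1 /data_mx mul_row_block !mul1mx mulmx0 add0r.
  by rewrite mulmxN mul_row_col addrC.
by rewrite /Pc trmx_mul trmxK !mulmxA.
Qed.

Theorem theorem1 (R : realType) (n m md N : nat)
    (n_gt0 : (0 < n)%N) (m_gt0 : (0 < m)%N)
    (md_gt0 : (0 < md)%N) (N_gt0 : (0 < N)%N)
    (Xdot X : 'M[R]_(n, N)) (U : 'M[R]_(m, N)) (Bd : 'M[R]_(n, md))
    (Bd_full_col_rank : \rank Bd = md)
    (Qd : 'M[R]_N) (Sd : 'M[R]_(N, md)) (Rd : 'M[R]_md)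
    (Qd_sym : Qd^T = Qd) (Rd_sym : Rd^T = Rd) (Qd_neg : negdefmx Qd)
    (Atr : 'M[R]_n) (Btr : 'M[R]_(n, m)) (Dhat : 'M[R]_(md, N))
    (Dhat_noise : noise_set Qd Sd Rd Dhat)
    (data_eq : Xdot = Atr *m X + Btr *m U + Bd *m Dhat) :
  Sigma_c Xdot X U Bd Qd Sd Rd =
  [set AB : 'M[R]_n * 'M[R]_(n, m) |
    psdmx ((col_mx (row_mx AB.1 AB.2)^T 1%:M)^T
             *m Pc Xdot X U Bd Qd Sd Rd
             *m col_mx (row_mx AB.1 AB.2)^T 1%:M)].
Proof.
have BdD D : row_mx (Bd *m D) Bd = Bd *m (col_mx D^T 1%:M)^T.
  by rewrite tr_col_mx trmxK trmx1 mul_mx_row mulmx1.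
apply/seteqP; split => -[A B] /=; rewrite tr_col_mx_Pc.
  move=> [D [D_noise ->]]; rewrite [_ + Bd *m D]addrC addrK BdD trmx_mul trmxK.
  by rewrite !mulmxA -!(mulmxA Bd) mulmxA; exact: psdmx_congr.
move=> psdE; have [D ED] := psdmx_row_mx_factor Qd_neg psdE.
exists D; split; last by rewrite -ED /= addrC subrK.
(* Full column rank is [row_full] here: the rows of [Bd] span the whole space, which yields a left
   inverse [C]. Congruence by [C] then strips [Bd] from both sides. *)
have /row_fullP[C CBd] : row_full Bd by rewrite /row_full Bd_full_col_rank.
have := psdmx_congr C psdE; rewrite ED BdD /noise_set /=.
set K := col_mx _ _; have -> : C *m (Bd *m K^T *m noise_mx Qd Sd Rd *m
    (Bd *m K^T)^T) *m C^T = (C *m Bd) *m (K^T *m noise_mx Qd Sd Rd *m K) *m (C *m Bd)^T.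
  by rewrite !trmx_mul trmxK !mulmxA.
by rewrite CBd trmx1 mul1mx mulmx1.
Qed.
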